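(* There exists a recursive coloring function $c:\mathbb{N}\rightarrow r$ (for some natural number $r\geq 2$) such that for every infinite $\Delta^0_3$ set $A\subseteq\mathbb{Z}^+$ with weak apartness, there exist $x\ll w_1\ll w_2$ in $A$ such that $c(w_1+w_2)\neq c(x+w_1+w_2)$. Hence $FS^{\leq 3}(A)$ is not monochromatic under $c$.
   Context: For $x=\sum_{i=0}^{k}2^{n_i}\in\mathbb{Z}^+$ with $n_0<\cdots<n_k$, set $\mu(x)=n_k$ and $\lambda(x)=n_0$. For positive integers $x<y$, write $x\ll y$ if $\mu(x)<\lambda(y)$. For each $n$, $B^n=\{x\in\mathbb{Z}^+:\mu(x)=n\}$. A set $A$ has weak apartness if for every natural number $m$, $B^m\cap A$ has at most one element, and for every natural number $l$, there are at most two $x\in A$ with $\lambda(x)=l$. $FS^{\leq 3}(A)=\{\sum_{x\in F}x: F\subseteq A,\ F \text{ nonempty},\ |F|\leq 3\}$. *)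

(* Defs.v *)
From Stdlib Require Import Arith List Lia.
Import ListNotations.

Inductive code : Type :=
| CZero : code
| CSucc : code
| CProj : nat -> code
| CComp : code -> list code -> code
| CPrec : code -> code -> code
| CMu   : code -> code.

Inductive eval : code -> list nat -> nat -> Prop :=
| eZero : forall v, eval CZero v 0
| eSucc : forall x v, eval CSucc (x :: v) (S x)
| eProj : forall i v, i < length v -> eval (CProj i) v (nth i v 0)
| eComp : forall f gs v ys y,
    Forall2 (fun g y => eval g v y) gs ys -> eval f ys y -> eval (CComp f gs) v y
| ePrec0 : forall f g v y, eval f v y -> eval (CPrec f g) (0 :: v) y
| ePrecS : forall f g n v z y,
    eval (CPrec f g) (n :: v) z -> eval g (n :: z :: v) y ->
    eval (CPrec f g) (S n :: v) y
| eMu : forall f v n,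
    eval f (n :: v) 0 ->
    (forall m, m < n -> exists k, eval f (m :: v) (S k)) ->
    eval (CMu f) v n.

Definition recursive_fun (f : nat -> nat) : Prop :=
  exists e, forall n, eval e [n] (f n).

Definition recursive_rel4 (R : nat -> nat -> nat -> nat -> Prop) : Prop :=
  exists e, forall x a b c,
    (R x a b c -> eval e [x; a; b; c] 0) /\ (~ R x a b c -> eval e [x; a; b; c] 1).

Definition Sigma03 (A : nat -> Prop) : Prop :=
  exists R, recursive_rel4 R /\
    forall x, A x <-> exists a, forall b, exists c, R x a b c.

Definition Pi03 (A : nat -> Prop) : Prop :=
  exists R, recursive_rel4 R /\
    forall x, A x <-> forall a, exists b, forall c, R x a b c.

Definition Delta03 (A : nat -> Prop) : Prop := Sigma03 A /\ Pi03 A.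

(** Binary-expansion exponents. For x = sum_{i<=k} 2^{n_i}, n_0 < ... < n_k:
    mu x = n_k (highest bit), lambda x = n_0 (lowest bit). *)
Definition mu (x : nat) : nat := Nat.log2 x.

Fixpoint tz (fuel x : nat) : nat :=
  match fuel with
  | 0 => 0
  | S f => if Nat.odd x then 0 else S (tz f (Nat.div2 x))
  end.

Definition lambda (x : nat) : nat := tz x x.

Definition ll (x y : nat) : Prop := x < y /\ mu x < lambda y.

Definition infinite_set (A : nat -> Prop) : Prop :=
  forall n, exists x, n < x /\ A x.

Definition weak_apartness (A : nat -> Prop) : Prop :=
  (forall m x y, A x -> A y -> mu x = m -> mu y = m -> x = y) /\
  (forall l x y z, A x -> A y -> A z ->
     lambda x = l -> lambda y = l -> lambda z = l ->
     x = y \/ x = z \/ y = z).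

Definition FS3 (A : nat -> Prop) (s : nat) : Prop :=
  exists F : list nat, NoDup F /\ 1 <= length F <= 3 /\
    (forall y, In y F -> A y) /\ s = fold_right Nat.add 0 F.

(* Main.v *)
Require Import Defs.
From Stdlib Require Import Arith List Lia Classical.
Import ListNotations.

(** This is Jockusch's construction of a computable coloring of pairs without
    infinite Sigma^0_2 homogeneous set, relativized to 0' and made computable again.

    Let [t] be the highest exponent of [n]. The color of [n] is the sum modulo 2,
    over consecutive exponents [m < s] of [n], of bits [flip s t m]. If [x << w1]
    and [w1 << w2], then the contributions of the exponents of [w1 + w2] are the
    same in [x + w1 + w2] and in [w1 + w2], so that the two colors differ by the
    color of [x] (computed with parameter [t]) plus [flip s t m], where [m = mu x]
    and [s = lambda w1]. It is therefore enough that [flip s t m] is 1 plus the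
    color of [x].

    At stage [(s, t)] every machine [e <= s] in turn picks an element [x] of the
    Sigma^0_3 set that it defines, as approximated at this stage, such that [mu x]
    differs from the choices of the machines before it, and fixes
    [flip s t (mu x)] in its favor. Only [e] machines come before [e], so [e + 1]
    candidates are enough for [e]; for [s] large, and [t] large depending on [s], the
    approximation is correct on these candidates. An [A] with unbounded [lambda]
    provides [w1] and [w2] for such [s] and [t]. *)

(** * Closure properties of total recursive functions *)

Definition computable (k : nat) (F : list nat -> nat) : Prop :=
  exists e, forall v, length v = k -> eval e v (F v).

Lemma computable_ext k F G :
  (forall v, F v = G v) -> computable k F -> computable k G.
Proof.
  intros E [e He]. exists e. intros v Hv. rewrite <- E. now apply He.
Qed.

Lemma computable_nth k i : i < k -> computable k (fun v => nth i v 0).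
Proof. intros Hi. exists (CProj i). intros v Hv. constructor. lia. Qed.

Lemma nth_tl i (v : list nat) : nth i (tl v) 0 = nth (S i) v 0.
Proof. destruct v; [destruct i|]; reflexivity. Qed.

Lemma computable_nth_tl k i : S i < k -> computable k (fun v => nth i (tl v) 0).
Proof.
  intros Hi. apply (computable_ext k (fun v => nth (S i) v 0)).
  - intros v. symmetry. apply nth_tl.
  - now apply computable_nth.
Qed.

Lemma computable_nth_tl2 k i :
  S (S i) < k -> computable k (fun v => nth i (tl (tl v)) 0).
Proof.
  intros Hi. apply (computable_ext k (fun v => nth (S (S i)) v 0)).
  - intros v. now rewrite !nth_tl.
  - now apply computable_nth.
Qed.

Lemma computable_compose k (F : list nat -> nat) (gs : list (list nat -> nat)) :
  computable (length gs) F -> Forall (computable k) gs ->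
  computable k (fun v => F (map (fun g => g v) gs)).
Proof.
  intros [f Hf] Hgs.
  assert (H : exists es, forall v, length v = k ->
            Forall2 (fun e y => eval e v y) es (map (fun g => g v) gs)).
  { clear Hf. induction Hgs as [|g gs [e He] _ [es IH]].
    - exists []. constructor.
    - exists (e :: es). intros v Hv. constructor; auto. }
  destruct H as [es Hes]. exists (CComp f es). intros v Hv.
  eapply eComp; [now apply Hes|]. apply Hf. now rewrite length_map.
Qed.

Definition computable1 (f : nat -> nat) : Prop :=
  forall k a, computable k a -> computable k (fun v => f (a v)).
Definition computable2 (f : nat -> nat -> nat) : Prop :=
  forall k a b, computable k a -> computable k b ->
  computable k (fun v => f (a v) (b v)).
Definition computable3 (f : nat -> nat -> nat -> nat) : Prop :=
  forall k a b c, computable k a -> computable k b -> computable k c ->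
  computable k (fun v => f (a v) (b v) (c v)).
Definition computable4 (f : nat -> nat -> nat -> nat -> nat) : Prop :=
  forall k a b c d,
  computable k a -> computable k b -> computable k c -> computable k d ->
  computable k (fun v => f (a v) (b v) (c v) (d v)).
Definition computable5 (f : nat -> nat -> nat -> nat -> nat -> nat) : Prop :=
  forall k a b c d e,
  computable k a -> computable k b -> computable k c -> computable k d ->
  computable k e -> computable k (fun v => f (a v) (b v) (c v) (d v) (e v)).

Lemma computable1_intro f :
  computable 1 (fun v => f (nth 0 v 0)) -> computable1 f.
Proof. intros Hf k a Ha. apply (computable_compose k _ [a] Hf); auto. Qed.

Lemma computable2_intro f :
  computable 2 (fun v => f (nth 0 v 0) (nth 1 v 0)) -> computable2 f.
Proof. intros Hf k a b Ha Hb. apply (computable_compose k _ [a; b] Hf); auto. Qed.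

Lemma computable3_intro f :
  computable 3 (fun v => f (nth 0 v 0) (nth 1 v 0) (nth 2 v 0)) -> computable3 f.
Proof. intros Hf k a b c **. apply (computable_compose k _ [a; b; c] Hf); auto. Qed.

Lemma computable4_intro f :
  computable 4 (fun v => f (nth 0 v 0) (nth 1 v 0) (nth 2 v 0) (nth 3 v 0)) ->
  computable4 f.
Proof.
  intros Hf k a b c d **. apply (computable_compose k _ [a; b; c; d] Hf); auto 6.
Qed.

Lemma eval_projections v :
  Forall2 (fun e y => eval e v y) (map CProj (seq 0 (length v))) v.
Proof.
  enough (H : forall suf pre, v = pre ++ suf ->
            Forall2 (fun e y => eval e v y)
              (map CProj (seq (length pre) (length suf))) suf)
    by exact (H v [] eq_refl).
  induction suf as [|x suf IH]; intros pre E; cbn; constructor.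
  - replace x with (nth (length pre) v 0).
    + constructor. rewrite E, length_app. cbn. lia.
    + rewrite E. apply nth_middle.
  - specialize (IH (pre ++ [x])). rewrite length_app, Nat.add_1_r in IH.
    apply IH. now rewrite <- app_assoc.
Qed.

Lemma computable_rec k a b (g : nat -> nat -> list nat -> nat) :
  computable k a -> computable k b ->
  computable (S (S k)) (fun w => g (nth 0 w 0) (nth 1 w 0) (tl (tl w))) ->
  computable k (fun v => nat_rect (fun _ => nat) (b v) (fun i r => g i r v) (a v)).
Proof.
  intros [ea Ha] [eb Hb] [eg Hg].
  exists (CComp (CPrec eb eg) (ea :: map CProj (seq 0 k))). intros v Hv.
  apply eComp with (ys := a v :: v).
  - constructor; [auto|]. rewrite <- Hv. apply eval_projections.
  - induction (a v) as [|n IH]; cbn [nat_rect].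
    + constructor. auto.
    + eapply ePrecS; [exact IH|]. apply (Hg (n :: _ :: v)). cbn. auto.
Qed.

Lemma computable_S k a : computable k a -> computable k (fun v => S (a v)).
Proof.
  apply (computable1_intro S). exists CSucc.
  intros [|x v] Hv; [discriminate|]. constructor.
Qed.

Lemma computable_const k c : computable k (fun _ => c).
Proof.
  induction c as [|c IH].
  - exists CZero. constructor.
  - exact (computable_S k _ IH).
Qed.

Create HintDb rec.
Hint Constants Opaque : rec.
Hint Resolve computable_nth computable_nth_tl computable_nth_tl2
  computable_S computable_const : rec.
Hint Extern 1 (_ < _) => lia : rec.

Definition ifz (z a b : nat) : nat := match z with 0 => a | S _ => b end.

Lemma computable_ifz : computable3 ifz.
Proof.
  apply computable3_intro, (computable_ext 3 (fun v => nat_rect (fun _ => nat) (nth 1 v 0)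
           (fun _ _ => nth 2 v 0) (nth 0 v 0))).
  - intros v. destruct (nth 0 v 0); reflexivity.
  - apply (computable_rec 3 _ _ (fun _ _ v => nth 2 v 0)); auto with rec.
Qed.
Hint Resolve computable_ifz : rec.

Lemma computable_add : computable2 Nat.add.
Proof.
  apply computable2_intro, (computable_ext 2 (fun v => nat_rect (fun _ => nat) (nth 1 v 0)
           (fun _ r => S r) (nth 0 v 0))).
  - intros v. induction (nth 0 v 0) as [|n IH]; cbn in *; congruence.
  - apply (computable_rec 2 _ _ (fun _ r _ => S r)); auto with rec.
Qed.
Hint Resolve computable_add : rec.

Lemma computable_mul : computable2 Nat.mul.
Proof.
  apply computable2_intro, (computable_ext 2 (fun v => nat_rect (fun _ => nat) 0
           (fun _ r => nth 1 v 0 + r) (nth 0 v 0))).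
  - intros v. induction (nth 0 v 0) as [|n IH]; cbn in *; congruence.
  - apply (computable_rec 2 _ _ (fun _ r v => nth 1 v 0 + r)); auto with rec.
Qed.
Hint Resolve computable_mul : rec.

Lemma computable_pow : computable2 Nat.pow.
Proof.
  apply computable2_intro, (computable_ext 2 (fun v => nat_rect (fun _ => nat) 1
           (fun _ r => nth 0 v 0 * r) (nth 1 v 0))).
  - intros v. induction (nth 1 v 0) as [|n IH]; cbn in *; congruence.
  - apply (computable_rec 2 _ _ (fun _ r v => nth 0 v 0 * r)); auto with rec.
Qed.
Hint Resolve computable_pow : rec.

Lemma computable_pred : computable1 Nat.pred.
Proof.
  apply computable1_intro, (computable_ext 1 (fun v => nat_rect (fun _ => nat) 0
           (fun i _ => i) (nth 0 v 0))).
  - intros v. destruct (nth 0 v 0); reflexivity.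
  - apply (computable_rec 1 _ _ (fun i _ _ => i)); auto with rec.
Qed.
Hint Resolve computable_pred : rec.

Lemma computable_sub : computable2 Nat.sub.
Proof.
  apply computable2_intro, (computable_ext 2 (fun v => nat_rect (fun _ => nat) (nth 0 v 0)
           (fun _ r => Nat.pred r) (nth 1 v 0))).
  - intros v. induction (nth 1 v 0) as [|n IH]; cbn [nat_rect]; lia.
  - apply (computable_rec 2 _ _ (fun _ r _ => Nat.pred r)); auto with rec.
Qed.
Hint Resolve computable_sub : rec.

(** Truth values are coded as in [recursive_rel4]: [0] stands for true. *)

Definition neq (x y : nat) : nat := (x - y) + (y - x).

Lemma neq_0 x y : neq x y = 0 <-> x = y.
Proof. unfold neq. lia. Qed.

Lemma neq_refl x : neq x x = 0.
Proof. now apply neq_0. Qed.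

Lemma computable_neq : computable2 neq.
Proof. apply computable2_intro. unfold neq. auto 10 with rec. Qed.
Hint Resolve computable_neq : rec.

Definition bforall (n : nat) (f : nat -> nat) : nat :=
  nat_rect (fun _ => nat) 0 (fun i r => r + f i) n.

Lemma bforall_0 n f : bforall n f = 0 <-> forall i, i < n -> f i = 0.
Proof.
  induction n as [|n IH]; cbn [bforall nat_rect]; [split; auto; lia|].
  fold (bforall n f). split.
  - intros H i Hi. destruct (Nat.eq_dec i n) as [->|]; [lia|]. apply IH; lia.
  - intros H. rewrite (H n) by lia. rewrite (proj2 IH); auto.
Qed.

Lemma computable_skip k (f : nat -> list nat -> nat) :
  computable (S k) (fun w => f (nth 0 w 0) (tl w)) ->
  computable (S (S k)) (fun w => f (nth 0 w 0) (tl (tl w))).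
Proof.
  intros [e He]. exists (CComp e (CProj 0 :: map CProj (seq 2 k))).
  intros [|i [|r v]] Hv; try discriminate. injection Hv as Hv.
  apply eComp with (ys := i :: v); [|apply (He (i :: v)); cbn; auto].
  constructor; [apply (eProj 0 (i :: r :: v)); cbn; lia|].
  pose proof (eval_projections (i :: r :: v)) as H. cbn in H. subst k.
  now inversion_clear H as [|? ? ? ? _ H']; inversion_clear H'.
Qed.

Lemma computable_bforall k a (f : nat -> list nat -> nat) :
  computable k a -> computable (S k) (fun w => f (nth 0 w 0) (tl w)) ->
  computable k (fun v => bforall (a v) (fun i => f i v)).
Proof.
  intros Ha Hf%computable_skip.
  apply (computable_rec k a _ (fun i r v => r + f i v)); auto with rec.
Qed.
Hint Resolve computable_bforall : rec.

(** The least [i < n] with [f i = 0], and [n] if there is none. *)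
Definition least (n : nat) (f : nat -> nat) : nat :=
  nat_rect (fun _ => nat) 0
    (fun i r => ifz (i - r) (ifz (f i) i (S i)) r) n.

Lemma least_le n f : least n f <= n.
Proof.
  induction n as [|n IH]; cbn [least nat_rect]; [lia|]. fold (least n f).
  destruct (n - least n f); cbn; [destruct (f n)|]; cbn; lia.
Qed.

Lemma least_lt n f i : i < least n f -> f i <> 0.
Proof.
  pose proof (least_le n f) as L.
  induction n as [|n IH]; cbn [least nat_rect] in *; [lia|].
  fold (least n f) in *. specialize (IH (least_le n f)).
  destruct (n - least n f) eqn:E; cbn [ifz] in *; auto.
  destruct (f n) eqn:F; cbn [ifz] in *; intros Hi.
  - apply IH. lia.
  - destruct (Nat.eq_dec i n); [congruence|]. apply IH. lia.
Qed.

Lemma least_0 n f : least n f < n -> f (least n f) = 0.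
Proof.
  induction n as [|n IH]; [lia|]. cbn [least nat_rect].
  fold (least n f). pose proof (least_le n f).
  destruct (n - least n f) eqn:E; cbn [ifz].
  - destruct (f n) eqn:F; cbn [ifz]; [auto|lia].
  - intros _. apply IH. lia.
Qed.

Lemma least_found n f i : f i = 0 -> least n f <= i.
Proof.
  intros Hf. destruct (Nat.le_gt_cases (least n f) i) as [|H]; [easy|].
  now apply least_lt in H.
Qed.

Lemma least_eq n f i :
  i <= n -> f i = 0 -> (forall j, j < i -> f j <> 0) -> least n f = i.
Proof.
  intros Hi Hf Hj. pose proof (least_le n f).
  destruct (lt_eq_lt_dec (least n f) i) as [[H1|H1]|H1]; auto; exfalso.
  - apply (Hj _ H1). apply least_0. lia.
  - now apply (least_lt n f i).
Qed.

Lemma computable_least k a (f : nat -> list nat -> nat) :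
  computable k a -> computable (S k) (fun w => f (nth 0 w 0) (tl w)) ->
  computable k (fun v => least (a v) (fun i => f i v)).
Proof.
  intros Ha Hf%computable_skip.
  apply (computable_rec k a _
    (fun i r v => ifz (i - r) (ifz (f i v) i (S i)) r)); auto 10 with rec.
Qed.
Hint Resolve computable_least : rec.

(** * Pairs, lists and course-of-values recursion *)

Lemma computable_sqrt : computable1 Nat.sqrt.
Proof.
  apply computable1_intro, (computable_ext 1 (fun v =>
    least (nth 0 v 0) (fun y => S (nth 0 v 0) - S y * S y))).
  - intros v. set (n := nth 0 v 0).
    pose proof (Nat.sqrt_spec' n). apply least_eq.
    + apply Nat.sqrt_le_lin.
    + lia.
    + intros j Hj. enough (S j * S j <= Nat.sqrt n * Nat.sqrt n) by lia.
      apply Nat.mul_le_mono; lia.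
  - apply computable_least; auto 10 with rec.
Qed.
Hint Resolve computable_sqrt : rec.

Lemma computable_log2 : computable1 Nat.log2.
Proof.
  apply computable1_intro, (computable_ext 1 (fun v =>
    least (nth 0 v 0) (fun y => S (nth 0 v 0) - 2 ^ S y))).
  - intros v. set (n := nth 0 v 0). apply least_eq.
    + apply Nat.log2_le_lin. lia.
    + destruct (Nat.eq_0_gt_0_cases n) as [->|Hn]; [reflexivity|].
      pose proof (Nat.log2_spec n Hn). lia.
    + intros j Hj. assert (0 < n) by (destruct n; cbn in Hj; lia).
      pose proof (Nat.log2_spec n).
      pose proof (Nat.pow_le_mono_r 2 (S j) (Nat.log2 n)). lia.
  - apply computable_least; auto 10 with rec.
Qed.
Hint Resolve computable_log2 : rec.

(** Unlike Cantor's pairing this one is not surjective, but [Nat.sqrt] inverts it. *)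
Definition cpair (x y : nat) : nat := (x + y) * (x + y) + x.
Definition cfst (p : nat) : nat := p - Nat.sqrt p * Nat.sqrt p.
Definition csnd (p : nat) : nat := Nat.sqrt p - cfst p.

Lemma sqrt_cpair x y : Nat.sqrt (cpair x y) = x + y.
Proof. apply Nat.sqrt_unique. unfold cpair. lia. Qed.

Lemma cfst_cpair x y : cfst (cpair x y) = x.
Proof. unfold cfst. rewrite sqrt_cpair. unfold cpair. lia. Qed.

Lemma csnd_cpair x y : csnd (cpair x y) = y.
Proof. unfold csnd. rewrite sqrt_cpair, cfst_cpair. lia. Qed.

Lemma cfst_le p : cfst p <= p.
Proof. unfold cfst. lia. Qed.

Lemma computable_cpair : computable2 cpair.
Proof. apply computable2_intro. unfold cpair. auto 10 with rec. Qed.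
Hint Resolve computable_cpair : rec.

Lemma computable_cfst : computable1 cfst.
Proof. apply computable1_intro. unfold cfst. auto 10 with rec. Qed.
Hint Resolve computable_cfst : rec.

Lemma computable_csnd : computable1 csnd.
Proof. apply computable1_intro. unfold csnd. auto 10 with rec. Qed.
Hint Resolve computable_csnd : rec.

Definition ccons (x l : nat) : nat := S (cpair x l).
Definition chd (l : nat) : nat := cfst (Nat.pred l).
Definition ctl (l : nat) : nat := csnd (Nat.pred l).
Definition cskip (i l : nat) : nat := nat_rect (fun _ => nat) l (fun _ r => ctl r) i.
Definition cnth (i l : nat) : nat := chd (cskip i l).
Definition clist (l : list nat) : nat := fold_right ccons 0 l.

Lemma clist_nil : clist [] = 0.
Proof. reflexivity. Qed.

Lemma clist_cons x l : clist (x :: l) = ccons x (clist l).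
Proof. reflexivity. Qed.

Lemma ifz_ccons x l a b : ifz (ccons x l) a b = b.
Proof. reflexivity. Qed.

Lemma chd_ccons x l : chd (ccons x l) = x.
Proof. apply cfst_cpair. Qed.

Lemma ctl_ccons x l : ctl (ccons x l) = l.
Proof. apply csnd_cpair. Qed.

Lemma cnth_S i x l : cnth (S i) (ccons x l) = cnth i l.
Proof.
  unfold cnth. f_equal. induction i as [|i IH].
  - apply ctl_ccons.
  - change (ctl (cskip (S i) (ccons x l)) = ctl (cskip i l)). now rewrite IH.
Qed.

Lemma cnth_clist i l : i < length l -> cnth i (clist l) = nth i l 0.
Proof.
  revert i. induction l as [|x l IH]; intros i Hi; [inversion Hi|].
  destruct i as [|i]; cbn [clist fold_right nth].
  - apply chd_ccons.
  - rewrite cnth_S. apply IH. cbn in Hi. lia.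
Qed.

Lemma computable_ccons : computable2 ccons.
Proof. apply computable2_intro. unfold ccons. auto 10 with rec. Qed.
Hint Resolve computable_ccons : rec.

Lemma computable_chd : computable1 chd.
Proof. apply computable1_intro. unfold chd. auto 10 with rec. Qed.
Hint Resolve computable_chd : rec.

Lemma computable_ctl : computable1 ctl.
Proof. apply computable1_intro. unfold ctl. auto 10 with rec. Qed.
Hint Resolve computable_ctl : rec.

Lemma computable_cnth : computable2 cnth.
Proof.
  apply computable2_intro, computable_chd.
  apply (computable_rec 2 _ _ (fun _ r _ => ctl r)); auto 10 with rec.
Qed.
Hint Resolve computable_cnth : rec.

(** [history G n] lists the values at [n - 1, ..., 0] of the function defined from
    [G] by course-of-values recursion. *)
Definition history (G : nat -> nat -> nat) (n : nat) : nat :=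
  nat_rect (fun _ => nat) 0 (fun i h => ccons (G i h) h) n.
Definition hget (h n i : nat) : nat := cnth (n - S i) h.

Lemma hget_history G n i :
  i < n -> hget (history G n) n i = G i (history G i).
Proof.
  unfold hget. intros Hi. replace n with (S i + (n - S i)) at 2 by lia.
  induction (n - S i) as [|d IH].
  - rewrite Nat.add_0_r. apply chd_ccons.
  - rewrite Nat.add_succ_r. cbn [history nat_rect]. now rewrite cnth_S.
Qed.

Lemma computable_hget : computable3 hget.
Proof. apply computable3_intro. unfold hget. auto 10 with rec. Qed.
Hint Resolve computable_hget : rec.

Lemma computable_history k a (G : nat -> nat -> list nat -> nat) :
  computable k a ->
  computable (S (S k)) (fun w => G (nth 0 w 0) (nth 1 w 0) (tl (tl w))) ->
  computable k (fun v => history (fun i h => G i h v) (a v)).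
Proof.
  intros Ha HG.
  apply (computable_rec k a _ (fun i h v => ccons (G i h v) h)); auto with rec.
Qed.
Hint Resolve computable_history : rec.

(** * A universal machine *)

Definition quad (a b c d : nat) : nat := cpair (cpair a b) (cpair c d).
Definition q1 (s : nat) : nat := cfst (cfst s).
Definition q2 (s : nat) : nat := csnd (cfst s).
Definition q3 (s : nat) : nat := cfst (csnd s).
Definition q4 (s : nat) : nat := csnd (csnd s).

Lemma q1_quad a b c d : q1 (quad a b c d) = a.
Proof. unfold q1, quad. now rewrite !cfst_cpair. Qed.
Lemma q2_quad a b c d : q2 (quad a b c d) = b.
Proof. unfold q2, quad. now rewrite cfst_cpair, csnd_cpair. Qed.
Lemma q3_quad a b c d : q3 (quad a b c d) = c.
Proof. unfold q3, quad. now rewrite csnd_cpair, cfst_cpair. Qed.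
Lemma q4_quad a b c d : q4 (quad a b c d) = d.
Proof. unfold q4, quad. now rewrite !csnd_cpair. Qed.

Hint Rewrite clist_nil clist_cons ifz_ccons cfst_cpair csnd_cpair chd_ccons
  ctl_ccons q1_quad q2_quad q3_quad q4_quad : proj.

Lemma computable_quad : computable4 quad.
Proof. apply computable4_intro. unfold quad. auto 10 with rec. Qed.
Lemma computable_q1 : computable1 q1.
Proof. apply computable1_intro. unfold q1. auto 10 with rec. Qed.
Lemma computable_q2 : computable1 q2.
Proof. apply computable1_intro. unfold q2. auto 10 with rec. Qed.
Lemma computable_q3 : computable1 q3.
Proof. apply computable1_intro. unfold q3. auto 10 with rec. Qed.
Lemma computable_q4 : computable1 q4.
Proof. apply computable1_intro. unfold q4. auto 10 with rec. Qed.
Hint Resolve computable_quad computable_q1 computable_q2 computable_q3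
  computable_q4 : rec.

(** The argument codes of a composition are stored in reverse order, so that the
    machine can evaluate them from the last to the first and push the values. *)
Fixpoint enc (e : code) : nat :=
  match e with
  | CZero => cpair 0 0
  | CSucc => cpair 1 0
  | CProj i => cpair 2 i
  | CComp f gs => cpair 3 (cpair (enc f) (clist (rev (map enc gs))))
  | CPrec f g => cpair 4 (cpair (enc f) (enc g))
  | CMu f => cpair 5 (enc f)
  end.

(** A state is [quad 0 e v k] (evaluate the code [e] at [v]), [quad 1 y 0 k] (return
    [y]) or [quad 2 fr 0 k] (evaluate the next argument of the composition frame
    [fr]), where [k] is the stack of frames. The frames are:
    - [quad (cpair 0 f) gs v ys]: composition of [f] with pending arguments [gs] at
      [v] and computed arguments [ys];
    - [quad (cpair 1 g) i n v]: recursion with step [g], [i] out of [n] rounds begun;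
    - [quad (cpair 2 f) i v 0]: minimization of [f] at [v], [i] being tested. *)
Definition step_eval (e v k : nat) : nat :=
  ifz (cfst e) (quad 1 0 0 k)
  (ifz (cfst e - 1) (quad 1 (S (chd v)) 0 k)
  (ifz (cfst e - 2) (quad 1 (cnth (csnd e) v) 0 k)
  (ifz (cfst e - 3)
    (quad 2 (quad (cpair 0 (cfst (csnd e))) (csnd (csnd e)) v 0) 0 k)
  (ifz (cfst e - 4)
    (quad 0 (cfst (csnd e)) (ctl v)
      (ccons (quad (cpair 1 (csnd (csnd e))) 0 (chd v) (ctl v)) k))
    (quad 0 (csnd e) (ccons 0 v) (ccons (quad (cpair 2 (csnd e)) 0 v 0) k)))))).

Definition step_return (y fr k : nat) : nat :=
  ifz (cfst (q1 fr))
    (quad 2 (quad (q1 fr) (q2 fr) (q3 fr) (ccons y (q4 fr))) 0 k)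
  (ifz (cfst (q1 fr) - 1)
    (ifz (neq (q2 fr) (q3 fr))
      (quad 1 y 0 k)
      (quad 0 (csnd (q1 fr)) (ccons (q2 fr) (ccons y (q4 fr)))
        (ccons (quad (q1 fr) (S (q2 fr)) (q3 fr) (q4 fr)) k)))
    (ifz y
      (quad 1 (q2 fr) 0 k)
      (quad 0 (csnd (q1 fr)) (ccons (S (q2 fr)) (q3 fr))
        (ccons (quad (q1 fr) (S (q2 fr)) (q3 fr) 0) k)))).

Definition step_arg (fr k : nat) : nat :=
  ifz (q2 fr)
    (quad 0 (csnd (q1 fr)) (q4 fr) k)
    (quad 0 (chd (q2 fr)) (q3 fr)
      (ccons (quad (q1 fr) (ctl (q2 fr)) (q3 fr) (q4 fr)) k)).

Definition step (s : nat) : nat :=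
  ifz (q1 s) (step_eval (q2 s) (q3 s) (q4 s))
  (ifz (q1 s - 1)
    (ifz (q4 s) s (step_return (q2 s) (chd (q4 s)) (ctl (q4 s))))
    (step_arg (q2 s) (q4 s))).

Lemma computable_step_eval : computable3 step_eval.
Proof. apply computable3_intro. unfold step_eval. auto 20 with rec. Qed.
Lemma computable_step_return : computable3 step_return.
Proof. apply computable3_intro. unfold step_return. auto 20 with rec. Qed.
Lemma computable_step_arg : computable2 step_arg.
Proof. apply computable2_intro. unfold step_arg. auto 20 with rec. Qed.
Hint Resolve computable_step_eval computable_step_return computable_step_arg : rec.

Lemma computable_step : computable1 step.
Proof. apply computable1_intro. unfold step. auto 20 with rec. Qed.
Hint Resolve computable_step : rec.

Definition run (t s : nat) : nat := nat_rect (fun _ => nat) s (fun _ r => step r) t.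

Lemma computable_run : computable2 run.
Proof.
  apply computable2_intro.
  apply (computable_rec 2 _ _ (fun _ r _ => step r)); auto with rec.
Qed.
Hint Resolve computable_run : rec.

Lemma run_add t u s : run (t + u) s = run t (run u s).
Proof.
  induction t as [|t IH]; [reflexivity|].
  change (step (run (t + u) s) = step (run t (run u s))). now rewrite IH.
Qed.

Definition reach (s s' : nat) : Prop := exists t, run t s = s'.

Lemma reach_trans s1 s2 s3 : reach s1 s2 -> reach s2 s3 -> reach s1 s3.
Proof.
  intros [t <-] [u <-]. exists (u + t). apply run_add.
Qed.

Lemma reach_step s s' : reach (step s) s' -> reach s s'.
Proof. apply reach_trans. now exists 1. Qed.

Lemma reach_refl s : reach s s.
Proof. now exists 0. Qed.

Ltac machine_step :=
  apply reach_step; unfold step; autorewrite with proj; cbn [ifz Nat.sub];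
  unfold step_eval, step_return, step_arg; autorewrite with proj; cbn [ifz Nat.sub].

Lemma eval_strong_ind (P : code -> list nat -> nat -> Prop) :
  (forall v, P CZero v 0) ->
  (forall x v, P CSucc (x :: v) (S x)) ->
  (forall i v, i < length v -> P (CProj i) v (nth i v 0)) ->
  (forall f gs v ys y, Forall2 (fun g y => P g v y) gs ys ->
     P f ys y -> P (CComp f gs) v y) ->
  (forall f g v y, P f v y -> P (CPrec f g) (0 :: v) y) ->
  (forall f g n v z y, P (CPrec f g) (n :: v) z -> P g (n :: z :: v) y ->
     P (CPrec f g) (S n :: v) y) ->
  (forall f v n, P f (n :: v) 0 ->
     (forall m, m < n -> exists k, P f (m :: v) (S k)) -> P (CMu f) v n) ->
  forall e v y, eval e v y -> P e v y.
Proof.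
  intros H1 H2 H3 H4 H5 H6 H7.
  fix IH 4. intros e v y [ | | | f gs v' ys y' Hgs Hf | | | f v' n Hf Hlt].
  - apply H1.
  - apply H2.
  - now apply H3.
  - apply (H4 f gs v' ys y'); [|now apply IH].
    clear Hf. induction Hgs as [|g y0 gs ys Hg _ IHgs]; constructor; auto.
  - apply H5. now apply IH.
  - eapply H6; apply IH; eassumption.
  - apply H7; [now apply IH|]. intros m Hm.
    destruct (Hlt m Hm) as [k Hk]. exists k. now apply IH.
Qed.

(** The second conjunct follows the recursion downwards from [n], while the machine
    counts upwards to a fixed bound [N]. *)
Lemma eval_reach e v y :
  eval e v y ->
  (forall k, reach (quad 0 (enc e) (clist v) k) (quad 1 y 0 k)) /\
  (forall f g n w, e = CPrec f g -> v = n :: w -> forall N k, n <= N ->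
     reach (quad 0 (enc f) (clist w)
              (ccons (quad (cpair 1 (enc g)) 0 N (clist w)) k))
           (quad 1 y 0 (ccons (quad (cpair 1 (enc g)) n N (clist w)) k))).
Proof.
  assert (loop_done : forall f g n w y k,
    reach (quad 0 (enc f) (clist w)
            (ccons (quad (cpair 1 (enc g)) 0 n (clist w)) k))
          (quad 1 y 0 (ccons (quad (cpair 1 (enc g)) n n (clist w)) k)) ->
    reach (quad 0 (enc (CPrec f g)) (clist (n :: w)) k) (quad 1 y 0 k)).
  { intros f g n w y' k H. cbn [enc]. machine_step.
    eapply reach_trans; [exact H|]. machine_step. rewrite neq_refl. cbn [ifz].
    apply reach_refl. }
  intros H.
  induction H as
    [v|x v|i v Hi|f gs v ys y H IH|f g v y IH|f g n v z y IH1 IH2|f v n IH Hlt]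
    using eval_strong_ind.
  - split; [|discriminate]. intros k. cbn [enc]. machine_step. apply reach_refl.
  - split; [|discriminate]. intros k. cbn [enc]. machine_step. apply reach_refl.
  - split; [|discriminate]. intros k. cbn [enc]. machine_step.
    rewrite cnth_clist by assumption. apply reach_refl.
  - split; [|discriminate]. intros k. cbn [enc].
    assert (Hargs : forall rest zs,
      reach (quad 2 (quad (cpair 0 (enc f)) (clist (rev (map enc gs) ++ rest))
                       (clist v) (clist zs)) 0 k)
            (quad 2 (quad (cpair 0 (enc f)) (clist rest)
                       (clist v) (clist (ys ++ zs))) 0 k)).
    { clear IH. induction H as [|g y0 gs ys Hg _ IH]; intros rest zs.
      - cbn [map rev app]. apply reach_refl.
      - cbn [map rev]. rewrite <- app_assoc. eapply reach_trans; [apply IH|].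
        cbn [app]. machine_step.
        eapply reach_trans; [apply (proj1 Hg)|]. machine_step. apply reach_refl. }
    machine_step. specialize (Hargs [] []). rewrite !app_nil_r in Hargs.
    rewrite clist_nil in Hargs.
    eapply reach_trans; [exact Hargs|]. machine_step. apply (proj1 IH).
  - assert (L : forall N k,
      reach (quad 0 (enc f) (clist v)
              (ccons (quad (cpair 1 (enc g)) 0 N (clist v)) k))
            (quad 1 y 0 (ccons (quad (cpair 1 (enc g)) 0 N (clist v)) k)))
      by (intros; apply (proj1 IH)).
    split; [intros k; now apply loop_done|].
    intros f' g' n w [= <- <-] [= <- <-] N k _. apply L.
  - assert (L : forall N k, S n <= N ->
      reach (quad 0 (enc f) (clist v)
              (ccons (quad (cpair 1 (enc g)) 0 N (clist v)) k))
            (quad 1 y 0 (ccons (quad (cpair 1 (enc g)) (S n) N (clist v)) k))).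
    { intros N k HN. eapply reach_trans.
      - apply (proj2 IH1 f g n v eq_refl eq_refl N). lia.
      - machine_step. destruct (neq n N) eqn:E.
        + unfold neq in E. lia.
        + cbn [ifz]. rewrite <- !clist_cons. apply (proj1 IH2). }
    split; [intros k; now apply loop_done, L|].
    intros f' g' n' w [= <- <-] [= <- <-] N k HN. now apply L.
  - split; [|discriminate]. intros k. cbn [enc]. machine_step. rewrite <- clist_cons.
    assert (L : forall i, i <= n ->
      reach (quad 0 (enc f) (clist (0 :: v))
              (ccons (quad (cpair 2 (enc f)) 0 (clist v) 0) k))
            (quad 0 (enc f) (clist (i :: v))
              (ccons (quad (cpair 2 (enc f)) i (clist v) 0) k))).
    { induction i as [|i IHi]; intros Hi; [apply reach_refl|].
      eapply reach_trans; [apply IHi; lia|].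
      destruct (Hlt i Hi) as [y Hy].
      eapply reach_trans; [apply (proj1 Hy)|]. machine_step. rewrite <- clist_cons.
      apply reach_refl. }
    eapply reach_trans; [now apply L|].
    eapply reach_trans; [apply (proj1 IH)|]. machine_step. apply reach_refl.
Qed.

(** Here [p] codes the pair of the first two arguments of the relation. *)
Definition accepts (e p b c t : nat) : nat :=
  neq (run t (quad 0 e (clist [cfst p; csnd p; b; c]) 0)) (quad 1 0 0 0).

Lemma run_halted t y : run t (quad 1 y 0 0) = quad 1 y 0 0.
Proof.
  induction t as [|t IH]; cbn [run nat_rect]; [reflexivity|].
  fold (run t (quad 1 y 0 0)). rewrite IH. unfold step.
  autorewrite with proj. reflexivity.
Qed.

Lemma accepts_eventually e p b c :
  eval e [cfst p; csnd p; b; c] 0 ->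
  exists t0, forall t, t0 <= t -> accepts (enc e) p b c t = 0.
Proof.
  intros H. destruct (proj1 (eval_reach _ _ _ H) 0) as [t0 Ht0].
  exists t0. intros t Ht. apply neq_0.
  replace t with ((t - t0) + t0) by lia. rewrite run_add, Ht0. apply run_halted.
Qed.

Lemma accepts_never e p b c t :
  eval e [cfst p; csnd p; b; c] 1 -> accepts (enc e) p b c t <> 0.
Proof.
  intros H E. apply (proj1 (neq_0 _ _)) in E.
  destruct (proj1 (eval_reach _ _ _ H) 0) as [u Hu].
  enough (quad 1 1 0 0 = quad 1 0 0 0) as Q by
    (apply (f_equal q2) in Q; now rewrite !q2_quad in Q).
  rewrite <- (run_halted t 1), <- (run_halted u 0), <- E, <- Hu, <- !run_add.
  f_equal. lia.
Qed.

Lemma computable_accepts : computable5 accepts.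
Proof.
  intros k e p b c t **. unfold accepts. cbn [clist fold_right]. auto 20 with rec.
Qed.
Hint Resolve computable_accepts : rec.

(** * The coloring *)

Definition looks_at (e p b t : nat) : nat :=
  S (least (S t) (fun c => accepts e p b c t)) - S t.

(** [0] if at stage [(s, t)] the pair [p = (x, a)] looks as if [a] witnessed the
    membership of [x] in the Sigma^0_3 set given by the machine [e]. *)
Definition looks (e p s t : nat) : nat :=
  bforall (S s) (fun b => looks_at e p b t).

Lemma looks_at_0 e p b t :
  looks_at e p b t = 0 <-> exists c, c <= t /\ accepts e p b c t = 0.
Proof.
  unfold looks_at. split.
  - intros H. exists (least (S t) (fun c => accepts e p b c t)).
    pose proof (least_le (S t) (fun c => accepts e p b c t)).
    split; [lia|]. apply (least_0 _ (fun c => accepts e p b c t)). lia.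
  - intros (c & Hc & H).
    assert (least (S t) (fun c => accepts e p b c t) <= c)
      by (apply least_found; exact H).
    lia.
Qed.

Lemma computable_looks_at : computable4 looks_at.
Proof.
  apply computable4_intro. unfold looks_at. auto 10 with rec.
Qed.
Hint Resolve computable_looks_at : rec.

Lemma computable_looks : computable4 looks.
Proof.
  apply computable4_intro. apply computable_bforall; auto 10 with rec.
Qed.
Hint Resolve computable_looks : rec.

Lemma looks_limit e (R : nat -> nat -> nat -> nat -> Prop) :
  (forall x a b c,
    (R x a b c -> eval e [x; a; b; c] 0) /\ (~ R x a b c -> eval e [x; a; b; c] 1)) ->
  forall P, exists s0, forall s, s0 <= s -> exists t0, forall t, t0 <= t ->
  forall p, p < P ->
  (looks (enc e) p s t = 0 <-> forall b, exists c, R (cfst p) (csnd p) b c).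
Proof.
  intros HR P. induction P as [|P (s0 & H0)].
  { exists 0. intros s _. exists 0. lia. }
  destruct (classic (forall b, exists c, R (cfst P) (csnd P) b c)) as [HT|HF].
  - exists s0. intros s Hs. destruct (H0 s Hs) as [t0 Ht0].
    assert (L : forall n, exists t1, forall t, t1 <= t -> forall b, b < n ->
              looks_at (enc e) P b t = 0).
    { induction n as [|n [t1 Ht1]]; [exists 0; lia|].
      destruct (HT n) as [c Hc].
      destruct (accepts_eventually e P n c) as [t2 Ht2]; [now apply HR|].
      exists (t1 + t2 + c). intros t Ht b Hb.
      destruct (Nat.eq_dec b n) as [->|]; [|apply Ht1; lia].
      apply looks_at_0. exists c. split; [lia|apply Ht2; lia]. }
    destruct (L (S s)) as [t1 Ht1]. exists (t0 + t1). intros t Ht p Hp.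
    destruct (Nat.eq_dec p P) as [->|]; [|apply Ht0; lia].
    split; [auto|]. intros _. apply bforall_0. intros b Hb. apply Ht1; lia.
  - apply not_all_ex_not in HF as [b Hb].
    exists (s0 + b). intros s Hs. destruct (H0 s) as [t0 Ht0]; [lia|].
    exists t0. intros t Ht p Hp.
    destruct (Nat.eq_dec p P) as [->|]; [|apply Ht0; lia].
    split; [|intros H; now destruct (Hb (H b))].
    intros H. exfalso. unfold looks in H. rewrite bforall_0 in H.
    destruct (proj1 (looks_at_0 (enc e) P b t)) as (c & _ & Hc); [apply H; lia|].
    revert Hc. apply accepts_never, HR. intros HRc. apply Hb. now exists c.
Qed.

(** At stage [(s, t)], the machines [0, 1, ..., s] choose one after the other an
    element of the sets they define, with distinct values of [mu]; [0] means that no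
    choice was possible. *)
Definition fresh (h e m : nat) : nat :=
  bforall e (fun i => 1 - neq (Nat.log2 (hget h e i)) m).
Definition suitable (s t e h p : nat) : nat :=
  looks e p s t + ((1 - Nat.log2 (cfst p)) + fresh h e (Nat.log2 (cfst p))).
Definition choice (s t e h : nat) : nat :=
  ifz (S s - least (S s) (fun p => suitable s t e h p)) 0
    (cfst (least (S s) (fun p => suitable s t e h p))).
Definition pick (s t e : nat) : nat := choice s t e (history (choice s t) e).

Lemma computable_fresh : computable3 fresh.
Proof. apply computable3_intro, computable_bforall; auto 10 with rec. Qed.
Hint Resolve computable_fresh : rec.

Lemma computable_suitable : computable5 suitable.
Proof. intros k s t e h p **. unfold suitable. auto 20 with rec. Qed.
Hint Resolve computable_suitable : rec.

Lemma computable_choice : computable4 choice.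
Proof.
  apply computable4_intro.
  unfold choice. auto 10 with rec.
Qed.
Hint Resolve computable_choice : rec.

Lemma computable_pick : computable3 pick.
Proof.
  apply computable3_intro. unfold pick. auto 10 with rec.
Qed.
Hint Resolve computable_pick : rec.

Lemma pick_le s t e : pick s t e <= s.
Proof.
  unfold pick, choice. set (l := least _ _).
  destruct (S s - l) eqn:E; cbn [ifz]; [lia|]. pose proof (cfst_le l). lia.
Qed.

Lemma pick_spec s t e (T : nat -> Prop) P l :
  P <= S s ->
  (forall p, p < P -> (looks e p s t = 0 <-> T p)) ->
  e < length l -> NoDup (map (fun p => Nat.log2 (cfst p)) l) ->
  (forall p, In p l -> T p /\ p < P /\ 0 < Nat.log2 (cfst p)) ->
  exists p, p < P /\ T p /\ pick s t e = cfst p /\ 0 < Nat.log2 (cfst p) /\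
    forall i, i < e -> Nat.log2 (pick s t i) <> Nat.log2 (cfst p).
Proof.
  intros HP Hlooks He Hl Hin.
  set (used := map (fun i => Nat.log2 (pick s t i)) (seq 0 e)).
  set (h := history (choice s t) e).
  assert (Hfresh : forall m, fresh h e m = 0 <-> ~ In m used).
  { intros m. unfold fresh. rewrite bforall_0. unfold used. rewrite in_map_iff. split.
    - intros H (i & Hi & Hie%in_seq). specialize (H i ltac:(lia)).
      unfold h in H. rewrite hget_history in H by lia. fold (pick s t i) in H.
      unfold neq in H. lia.
    - intros H i Hi. unfold h. rewrite hget_history by lia. fold (pick s t i).
      enough (neq (Nat.log2 (pick s t i)) m <> 0) by lia.
      intros E. apply (proj1 (neq_0 _ _)) in E. apply H. exists i. split; [auto|].
      apply in_seq. lia. }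
  assert (Hp : exists p, In p l /\ ~ In (Nat.log2 (cfst p)) used).
  { apply NNPP. intros H.
    assert (I : incl (map (fun p => Nat.log2 (cfst p)) l) used).
    { intros m (p & <- & Hp)%in_map_iff. apply NNPP. intros Hm. apply H. now exists p. }
    apply NoDup_incl_length in I; [|exact Hl]. unfold used in I.
    rewrite !length_map, length_seq in I. lia. }
  destruct Hp as (p & Hp & Hpu). destruct (Hin p Hp) as (HTp & HpP & Hmup).
  assert (Hsp : suitable s t e h p = 0).
  { unfold suitable.
    rewrite (proj2 (Hlooks p HpP) HTp), (proj2 (Hfresh (Nat.log2 (cfst p))) Hpu). lia. }
  set (q := least (S s) (fun p => suitable s t e h p)).
  assert (Epick : pick s t e = ifz (S s - q) 0 (cfst q)) by reflexivity.
  assert (Hqp : q <= p) by (apply least_found; exact Hsp).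
  assert (Hq : suitable s t e h q = 0)
    by (apply (least_0 _ (fun p => suitable s t e h p)); fold q; lia).
  unfold suitable in Hq.
  exists q. split; [lia|]. split; [apply Hlooks; lia|].
  split; [|split].
  - rewrite Epick. destruct (S s - q) eqn:E; [lia|reflexivity].
  - lia.
  - intros i Hi Ei. destruct (proj1 (Hfresh (Nat.log2 (cfst q)))); [lia|].
    rewrite <- Ei. unfold used. apply in_map_iff. exists i. split; [auto|].
    apply in_seq. lia.
Qed.

Definition chooser (s t m : nat) : nat :=
  least (S s) (fun e => neq (Nat.log2 (pick s t e)) m).

Lemma computable_chooser : computable3 chooser.
Proof. apply computable3_intro, computable_least; auto 10 with rec. Qed.
Hint Resolve computable_chooser : rec.

Definition cxor (a b : nat) : nat := ifz a b (1 - b).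

Lemma computable_cxor : computable2 cxor.
Proof. apply computable2_intro. unfold cxor. auto 10 with rec. Qed.
Hint Resolve computable_cxor : rec.

Definition rest (n : nat) : nat := n - 2 ^ Nat.log2 n.

Lemma computable_rest : computable1 rest.
Proof. apply computable1_intro. unfold rest. auto 10 with rec. Qed.
Hint Resolve computable_rest : rec.

(** [flip_of] is [flip] at the two highest exponents of [n], with the colors of the
    smaller numbers looked up in the history [h]. *)
Definition flip_of (t n h : nat) : nat :=
  ifz (S (Nat.log2 n) - chooser (Nat.log2 n) t (Nat.log2 (rest n))) 0
    (1 - hget h n (pick (Nat.log2 n) t (chooser (Nat.log2 n) t (Nat.log2 (rest n))))).
Definition color_of (t n h : nat) : nat :=
  ifz (rest n) 0 (cxor (hget h n (rest n)) (flip_of t n h)).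
Definition color (t n : nat) : nat := color_of t n (history (color_of t) n).
Definition flip (s t m : nat) : nat :=
  ifz (S s - chooser s t m) 0 (1 - color t (pick s t (chooser s t m))).

Lemma computable_flip_of : computable3 flip_of.
Proof. apply computable3_intro. unfold flip_of. auto 20 with rec. Qed.
Hint Resolve computable_flip_of : rec.

Lemma computable_color_of : computable3 color_of.
Proof. apply computable3_intro. unfold color_of. auto 20 with rec. Qed.
Hint Resolve computable_color_of : rec.

Lemma computable_color : computable2 color.
Proof.
  apply computable2_intro. unfold color. auto 10 with rec.
Qed.
Hint Resolve computable_color : rec.

Lemma color_lt_2 t n : color t n < 2.
Proof.
  unfold color, color_of, flip_of, cxor.
  destruct (rest n); cbn [ifz]; [lia|].
  destruct (hget _ _ _), (S (Nat.log2 n) - _); cbn [ifz]; lia.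
Qed.

Lemma log2_add_pow x s : x < 2 ^ s -> Nat.log2 (x + 2 ^ s) = s.
Proof. intros H. apply (Nat.log2_unique' _ _ x); lia. Qed.

Lemma color_pow t s : color t (2 ^ s) = 0.
Proof.
  unfold color, color_of, rest. rewrite Nat.log2_pow2 by lia.
  now rewrite Nat.sub_diag.
Qed.

Lemma color_add_pow t x s :
  0 < x -> x < 2 ^ s ->
  color t (x + 2 ^ s) = cxor (color t x) (flip s t (Nat.log2 x)).
Proof.
  intros H0 H1. unfold color at 1, color_of at 1, flip_of.
  replace (rest (x + 2 ^ s)) with x
    by (unfold rest; rewrite log2_add_pow by assumption; lia).
  rewrite log2_add_pow by assumption.
  pose proof (pick_le s t (chooser s t (Nat.log2 x))).
  pose proof (Nat.pow_gt_lin_r 2 s).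
  rewrite !hget_history by lia. destruct x; [lia|reflexivity].
Qed.

Lemma add_multiple_lt_pow u k z b :
  u < 2 ^ k -> Nat.divide (2 ^ k) z -> k <= b -> z < 2 ^ b -> u + z < 2 ^ b.
Proof.
  intros Hu [q ->] Hk. replace b with (b - k + k) by lia. rewrite Nat.pow_add_r.
  intros Hz. assert (q < 2 ^ (b - k)) by nia. nia.
Qed.

Lemma log2_multiple_ge k z : Nat.divide (2 ^ k) z -> 0 < z -> k <= Nat.log2 z.
Proof.
  intros D Hz. apply Nat.log2_le_pow2; [exact Hz|]. apply Nat.divide_pos_le; auto.
Qed.

Lemma log2_add_multiple u k z :
  u < 2 ^ k -> Nat.divide (2 ^ k) z -> 0 < z -> Nat.log2 (u + z) = Nat.log2 z.
Proof.
  intros Hu D Hz. pose proof (Nat.log2_spec z Hz). pose proof (log2_multiple_ge k z D Hz).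
  pose proof (add_multiple_lt_pow u k z (S (Nat.log2 z))).
  apply Nat.log2_unique; [lia|]. split; [lia|]. intuition lia.
Qed.

(** The higher exponents add the same summands to both colors, because [flip] only
    sees the exponents before and after a gap. *)
Lemma color_append t k u v z :
  0 < u < 2 ^ k -> 0 < v < 2 ^ k -> Nat.log2 u = Nat.log2 v ->
  Nat.divide (2 ^ k) z ->
  color t u <> color t v -> color t (u + z) <> color t (v + z).
Proof.
  intros Hu Hv Huv D Hne.
  induction z as [z IH] using (well_founded_induction Nat.lt_wf_0).
  destruct (Nat.eq_0_gt_0_cases z) as [->|Hz]; [now rewrite !Nat.add_0_r|].
  pose proof (log2_multiple_ge k z D Hz) as Hk.
  pose proof (Nat.log2_spec z Hz) as [H1 H2].
  set (b := Nat.log2 z) in *. cbn [Nat.pow] in H2.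
  set (z' := z - 2 ^ b).
  assert (D' : Nat.divide (2 ^ k) z').
  { apply Nat.divide_sub_r; [exact D|]. exists (2 ^ (b - k)).
    rewrite <- Nat.pow_add_r. f_equal. lia. }
  assert (Hlt : forall w, w < 2 ^ k -> w + z' < 2 ^ b)
    by (intros w Hw; apply (add_multiple_lt_pow w k); auto; lia).
  pose proof (Nat.pow_nonzero 2 b).
  specialize (IH z' ltac:(lia) D').
  replace (u + z) with (u + z' + 2 ^ b) by lia.
  replace (v + z) with (v + z' + 2 ^ b) by lia.
  rewrite !color_add_pow by (try apply Hlt; lia).
  replace (Nat.log2 (v + z')) with (Nat.log2 (u + z')).
  - pose proof (color_lt_2 t (u + z')). pose proof (color_lt_2 t (v + z')).
    assert (flip b t (Nat.log2 (u + z')) < 2)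
      by (unfold flip; destruct (S b - _); cbn [ifz]; lia).
    unfold cxor. destruct (color t (u + z')), (color t (v + z')); cbn [ifz]; lia.
  - destruct (Nat.eq_0_gt_0_cases z') as [->|Hz']; [now rewrite !Nat.add_0_r|].
    now rewrite !(log2_add_multiple _ k) by (auto; lia).
Qed.

Lemma tz_spec fuel x :
  0 < x <= fuel -> exists q, x = 2 ^ tz fuel x * (2 * q + 1).
Proof.
  revert x. induction fuel as [|f IH]; intros x Hx; [lia|]. cbn [tz].
  pose proof (Nat.div2_odd x) as E. destruct (Nat.odd x); cbn [Nat.b2n] in E.
  - exists (Nat.div2 x). cbn [Nat.pow]. lia.
  - destruct (IH (Nat.div2 x)) as [q Hq]; [lia|]. exists q. cbn [Nat.pow]. lia.
Qed.

Lemma lambda_spec x :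
  0 < x -> exists q, x = 2 ^ lambda x * (2 * q + 1).
Proof. intros Hx. apply tz_spec. lia. Qed.

Lemma pow_lambda_le x : 0 < x -> 2 ^ lambda x <= x.
Proof. intros [q Hq]%lambda_spec. rewrite Hq at 2. nia. Qed.

Lemma lambda_le_mu x : 0 < x -> lambda x <= mu x.
Proof. intros Hx. apply Nat.log2_le_pow2, pow_lambda_le; auto. Qed.

Lemma lambda_unbounded A :
  (forall x, A x -> 0 < x) -> infinite_set A -> weak_apartness A ->
  forall l n, exists x, A x /\ n < x /\ l <= lambda x.
Proof.
  intros HA0 HAi [_ HAw]. induction l as [|l IH]; intros n.
  { destruct (HAi n) as (x & Hx & HAx). exists x. repeat split; auto. lia. }
  destruct (IH n) as (x & HAx & Hx & Hlx).
  destruct (IH x) as (y & HAy & Hy & Hly).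
  destruct (IH y) as (z & HAz & Hz & Hlz).
  destruct (Nat.eq_dec (lambda x) l); [|exists x; repeat split; auto; lia].
  destruct (Nat.eq_dec (lambda y) l); [|exists y; repeat split; auto; lia].
  destruct (Nat.eq_dec (lambda z) l); [|exists z; repeat split; auto; lia].
  destruct (HAw l x y z) as [?|[?|?]]; auto; lia.
Qed.

Lemma pairs_with_distinct_mu (T : nat -> Prop) :
  (forall n, exists p, T p /\ n < cfst p) ->
  forall k, exists l, length l = k /\ NoDup (map (fun p => Nat.log2 (cfst p)) l) /\
    forall p, In p l -> T p /\ 0 < Nat.log2 (cfst p).
Proof.
  intros HT k.
  enough (H : exists l M, length l = k /\ NoDup (map (fun p => Nat.log2 (cfst p)) l) /\
            forall p, In p l -> T p /\ 0 < Nat.log2 (cfst p) <= M)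
    by (destruct H as (l & M & ? & ? & H); exists l; repeat split; auto; now apply H).
  induction k as [|k (l & M & Hk & Hl & HM)].
  { exists [], 0. split; [reflexivity|]. split; [constructor|easy]. }
  destruct (HT (2 ^ S M)) as (p & Hp & HpM).
  assert (HMp : S M <= Nat.log2 (cfst p)) by (apply Nat.log2_le_pow2; lia).
  exists (p :: l), (Nat.log2 (cfst p)). cbn [length map]. split; [auto|]. split.
  - constructor; [|exact Hl]. intros (q & Hq & Hin)%in_map_iff.
    apply HM in Hin. lia.
  - intros q [<-|Hin]; [split; [auto|lia]|]. apply HM in Hin. intuition lia.
Qed.

Lemma color_diagonalizes A :
  Sigma03 A -> (forall x, A x -> 0 < x) -> infinite_set A -> weak_apartness A ->
  exists x w1 w2, A x /\ A w1 /\ A w2 /\ ll x w1 /\ ll w1 w2 /\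
    color (Nat.log2 (w1 + w2)) (w1 + w2) <>
    color (Nat.log2 (x + w1 + w2)) (x + w1 + w2).
Proof.
  intros (R & [e0 HR] & HAR) HA0 HAi HAw. set (e := enc e0).
  set (T p := forall b, exists c, R (cfst p) (csnd p) b c).
  assert (HTA : forall p, T p -> A (cfst p))
    by (intros p Hp; apply HAR; now exists (csnd p)).
  destruct (pairs_with_distinct_mu T) with (k := S e) as (l & Hlen & Hl & HlT).
  { intros n. destruct (HAi n) as (x & Hx & [a Ha]%HAR). exists (cpair x a).
    unfold T. now rewrite cfst_cpair, csnd_cpair. }
  set (P := S (list_max l)).
  destruct (looks_limit e0 R HR P) as [s0 Hs0].
  destruct (lambda_unbounded A HA0 HAi HAw (s0 + e + P) 0) as (w1 & HA1 & H1 & Hl1).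
  set (s := lambda w1) in *.
  destruct (Hs0 s) as [t0 Ht0]; [lia|].
  destruct (lambda_unbounded A HA0 HAi HAw (t0 + S (mu w1)) w1) as (w2 & HA2 & H2 & Hl2).
  set (t := Nat.log2 w2).
  assert (Htl : lambda w2 <= t) by (apply lambda_le_mu; lia).
  destruct (pick_spec s t e T P l) as (p & HpP & HTp & Hpick & Hmu & Hnew).
  { lia. } { apply Ht0. lia. } { lia. } { exact Hl. }
  { intros p Hp. split; [now apply HlT|]. split; [|now apply HlT].
    pose proof (proj1 (list_max_le l _) (le_n _)) as HF.
    rewrite Forall_forall in HF. specialize (HF p Hp). unfold P. lia. }
  set (x := cfst p) in *.
  assert (Hxs : x < s) by (pose proof (cfst_le p); unfold x; lia).
  assert (H2s : s < 2 ^ s) by (apply Nat.pow_gt_lin_r; lia).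
  assert (H2w1 : 2 ^ s <= w1) by (apply pow_lambda_le; lia).
  assert (HAx : A x) by exact (HTA p HTp).
  assert (Hx0 : 0 < x) by auto.
  exists x, w1, w2. repeat split; auto; try lia.
  { change (Nat.log2 x < s). pose proof (Nat.log2_lt_lin x Hx0). lia. }
  assert (Hw1 : w1 < 2 ^ lambda w2).
  { apply Nat.log2_lt_pow2; [lia|]. unfold mu in Hl2. lia. }
  destruct (lambda_spec w1 H1) as [k1 E1]. fold s in E1.
  destruct (lambda_spec w2) as [k2 E2]; [lia|].
  assert (D2 : Nat.divide (2 ^ lambda w2) w2) by (exists (2 * k2 + 1); lia).
  replace (Nat.log2 (w1 + w2)) with t
    by (symmetry; apply (log2_add_multiple _ (lambda w2)); auto; lia).
  assert (Hxw1 : x + w1 < 2 ^ lambda w2).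
  { apply (add_multiple_lt_pow _ s); [lia| | |lia].
    - exists (2 * k1 + 1). lia.
    - pose proof (lambda_le_mu w1 H1). lia. }
  replace (Nat.log2 (x + w1 + w2)) with t
    by (symmetry; apply (log2_add_multiple _ (lambda w2)); auto; lia).
  assert (Hch : chooser s t (Nat.log2 x) = e).
  { apply least_eq; [lia| |].
    - rewrite Hpick. apply neq_refl.
    - intros j Hj E. apply (proj1 (neq_0 _ _)) in E. now apply (Hnew j). }
  assert (Hcol : color t (x + 2 ^ s) = 1).
  { rewrite color_add_pow by lia. unfold flip. rewrite Hch, Hpick.
    pose proof (color_lt_2 t x). destruct (S s - e) eqn:E; [lia|]. cbn [ifz]. unfold cxor.
    destruct (color t x) as [|[|]]; cbn; lia. }
  set (z := w1 + w2 - 2 ^ s).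
  replace (x + w1 + w2) with (x + 2 ^ s + z) by (unfold z; lia).
  replace (w1 + w2) with (2 ^ s + z) by (unfold z; lia).
  apply not_eq_sym, (color_append t (S s)).
  - cbn [Nat.pow]. lia.
  - cbn [Nat.pow]. lia.
  - rewrite log2_add_pow, Nat.log2_pow2; lia.
  - exists (k1 + 2 ^ (lambda w2 - S s) * (2 * k2 + 1)).
    pose proof (lambda_le_mu w1 H1).
    assert (E : 2 ^ lambda w2 = 2 ^ (lambda w2 - S s) * 2 ^ S s)
      by (rewrite <- Nat.pow_add_r; f_equal; lia).
    rewrite E in E2. cbn [Nat.pow] in *. unfold z. lia.
  - rewrite Hcol, color_pow. lia.
Qed.

Theorem theorem2p7 :
  exists r : nat, 2 <= r /\
  exists c : nat -> nat, recursive_fun c /\ (forall n, c n < r) /\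
  forall A : nat -> Prop,
    Delta03 A -> (forall x, A x -> 0 < x) -> infinite_set A -> weak_apartness A ->
    (exists x w1 w2, A x /\ A w1 /\ A w2 /\ ll x w1 /\ ll w1 w2 /\
                     c (w1 + w2) <> c (x + w1 + w2)) /\
    ~ (exists col, forall s, FS3 A s -> c s = col).
Proof.
  exists 2. split; [lia|]. exists (fun n => color (Nat.log2 n) n). split; [|split].
  - assert (H : computable 1 (fun v => color (Nat.log2 (nth 0 v 0)) (nth 0 v 0)))
      by auto 10 with rec.
    destruct H as [e He]. exists e. intros n. now apply (He [n]).
  - intros n. apply color_lt_2.
  - intros A [HS _] HA0 HAi HAw.
    destruct (color_diagonalizes A HS HA0 HAi HAw)
      as (x & w1 & w2 & HAx & HA1 & HA2 & Hx1 & H12 & Hc).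
    split; [now exists x, w1, w2|].
    intros [col Hcol]. apply Hc. transitivity col; [|symmetry]; apply Hcol.
    + exists [w1; w2]. destruct H12. repeat split; cbn; try lia.
      * repeat constructor; cbn; intuition lia.
      * intros y [<-|[<-|[]]]; auto.
    + exists [x; w1; w2]. destruct H12, Hx1. repeat split; cbn; try lia.
      * repeat constructor; cbn; intuition lia.
      * intros y [<-|[<-|[<-|[]]]]; auto.
Qed.
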